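(* Let $\mu$ and $\nu$ be two finite positive Borel measures on $\mathbb{C}$ with compact and infinite support. (i) If $\mu$ and $\nu$ exhibit relative weak asymptotic moments, then they also exhibit relative Cesàro weak asymptotic moments. (ii) If $\mu$ and $\nu$ exhibit relative ratio asymptotics, then they also exhibit relative weak asymptotic moments.
   Context: For a finite positive measure $\mu$ on $\mathbb{C}$ with compact and infinite support, $\{p_n(z;\mu)\}_{n\ge0}$ denotes the sequence of orthonormal polynomials: $p_n(\cdot;\mu)$ has degree $n$, positive leading coefficient $\kappa_n(\mu)>0$, and $\int p_n\overline{p_m}\,d\mu=\delta_{m,n}$. The monic orthogonal polynomial is $P_n(z;\mu)=\kappa_n(\mu)^{-1}p_n(z;\mu)$. Set $R_\mu=\sup\{|z|:z\in\mathrm{supp}(\mu)\}$. Let $\sigma_n(\mu)$ be the probability measure assigning weight $n^{-1}$ to each zero of $P_n(\cdot;\mu)$, counted with multiplicity. Relative ratio asymptotics: there is a non-negative integer $q$ so that $$\lim_{n\to\infty}\left(\frac{P_{n-1}(z;\mu)}{P_{n}(z;\mu)}-\frac{P_{n-q-1}(z;\nu)}{P_{n-q}(z;\nu)}\right)=0,\qquad |z|>\max\{R_{\mu},R_{\nu}\}.$$ Relative weak asymptotic moments: there is a non-negative integer $q$ so that $$\lim_{n\to\infty}\left(\int z^j|p_n(z;\mu)|^2d\mu(z)-\int z^j|p_{n-q}(z;\nu)|^2d\nu(z)\right)=0,\qquad j\in\mathbb{N}.$$ Relative Cesàro weak asymptotic moments: $$\lim_{n\to\infty}\left(\int z^jd\sigma_n(\mu)(z)-\int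 z^jd\sigma_n(\nu)(z)\right)=0,\qquad j\in\mathbb{N}.$$ *)

(* Defs.v *)
From HB Require Import structures.
From mathcomp Require Import all_boot all_order all_algebra.
From mathcomp Require Import complex.
From mathcomp Require Import all_classical all_reals all_analysis.

Set Implicit Arguments.
Unset Strict Implicit.
Unset Printing Implicit Defensive.

Import Order.TTheory GRing.Theory Num.Theory.
Import numFieldNormedType.Exports.

Local Open Scope classical_set_scope.
Local Open Scope ring_scope.
Local Open Scope complex_scope.

(* The complex plane with the Borel sigma-algebra of the modulus topology,
   which is the topology carried by the copy [R[i]^o] of [R[i]]. *)
Notation borelC R := (g_sigma_algebraType (@open R[i]^o)).

Section Definitions.
Variable R : realType.
Local Notation C := R[i].

Definition Cintegral (mu : {measure set (borelC R) -> \bar R})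
    (f : borelC R -> C) : C :=
  (\int[mu]_z complex.Re (f z)) +i* (\int[mu]_z complex.Im (f z)).

Definition msupport (mu : {measure set (borelC R) -> \bar R}) : set C^o :=
  [set z | forall U : set C^o, open U -> U z -> (0 < mu U)%E].

Definition msupport_radius (mu : {measure set (borelC R) -> \bar R}) : R :=
  sup [set Normc.normc z | z in msupport mu].

(* In the order of [C], [0 < x] means that [x] is real and positive. For [mu]
   of infinite compact support exactly one sequence [p] satisfies this. *)
Definition orthonormal_polys (mu : {measure set (borelC R) -> \bar R})
    (p : nat -> {poly C}) : Prop :=
  [/\ forall n, size (p n) = n.+1,
      forall n, 0 < lead_coef (p n) &
      forall n m, Cintegral mu (fun z => (p n).[z] * ((p m).[z])^*)
                  = (n == m)%:R].

Definition monic_poly (p : {poly C}) : {poly C} := (lead_coef p)^-1 *: p.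

Definition zeros (p : {poly C}) : seq C := sval (closed_field_poly_normal p).

Definition zero_counting (p : nat -> {poly C}) (n : nat) :
    {measure set (borelC R) -> \bar R} :=
  let s := zeros (monic_poly (p n)) in
  mscale (n%:R^-1)%:nng
    (msum (fun k => dirac (s`_k : borelC R)) (size s)).

Definition relative_ratio_asymptotics
    (mu nu : {measure set (borelC R) -> \bar R})
    (p q : nat -> {poly C}) : Prop :=
  exists l : nat, forall z : C,
    Num.max (msupport_radius mu) (msupport_radius nu) < Normc.normc z ->
    (monic_poly (p (n - 1)%N)).[z] / (monic_poly (p n)).[z]
    - (monic_poly (q (n - l - 1)%N)).[z] / (monic_poly (q (n - l)%N)).[z]
      @[n --> \oo] --> (0 : C^o).

Definition relative_weak_asymptotic_moments
    (mu nu : {measure set (borelC R) -> \bar R})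
    (p q : nat -> {poly C}) : Prop :=
  exists l : nat, forall j : nat,
    Cintegral mu (fun z => (z : C) ^+ j * `|(p n).[z]| ^+ 2)
    - Cintegral nu (fun z => (z : C) ^+ j * `|(q (n - l)%N).[z]| ^+ 2)
      @[n --> \oo] --> (0 : C^o).

Definition relative_cesaro_weak_asymptotic_moments
    (p q : nat -> {poly C}) : Prop :=
  forall j : nat,
    Cintegral (zero_counting p n) (fun z => (z : C) ^+ j)
    - Cintegral (zero_counting q n) (fun z => (z : C) ^+ j)
      @[n --> \oo] --> (0 : C^o).

End Definitions.

(* Main.v *)
Require Import Defs.
From HB Require Import structures.
From mathcomp Require Import all_boot all_order all_algebra.
From mathcomp Require Import complex.
From mathcomp Require Import all_classical all_reals all_analysis.
From mathcomp Require Import measurable_realfun.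
From mathcomp Require Import ring lra zify.
Set Implicit Arguments.
Unset Strict Implicit.
Unset Printing Implicit Defensive.
Import Order.TTheory GRing.Theory Num.Theory.
Import numFieldNormedType.Exports.
Local Open Scope classical_set_scope.
Local Open Scope ring_scope.

(** Let P_n be the monic orthogonal polynomials of a measure whose support lies
    in the disc of radius rho. On polynomials of degree at most n, reduction
    modulo P_n is the orthogonal projection onto degree less than n, so
    f |-> X f mod P_n is the compression of multiplication by z. It has norm at
    most rho, and its powers are f |-> X^i f mod P_n. Both implications are read
    off from these operators.

    From weak moments to zeros. The sum of the j-th powers of the zeros of P_n is
    the trace of multiplication by X^j on C[X]/(P_n). In the basis P_0, ...,
    P_(n-1) its k-th diagonal entry is the moment of z^j against |p_k|^2 dmu as
    soon as k + j < n. Hence the power sum and the sum of the first n moments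
    differ by at most 2 j rho^j ([sum_roots_moments]). After division by n only
    the Cesaro mean of the differences of moments remains, and shifting one of
    the sequences by l changes its sum by a bounded amount
    ([cesaro_shift_null]).

    From ratios to weak moments. The coefficient of z^(-i-1) in the expansion of
    P_n / P_(n+1) at infinity is the coefficient of X^n in X^i P_n mod P_(n+1).
    It is bounded by rho^i, and a resolvent estimate bounds the remainders of the
    expansion uniformly in n ([norm_Xn_mod_horner]). So the convergence of the
    ratios at large z passes to each coefficient ([laurent_ortho_shift_equiv]).
    Multiplying consecutive ratios gives the expansions of P_(m-d) / P_(m+1)
    ([laurent_convolution]), and the coefficients of z^j P_(m-j) along the P_k
    are recovered from these by solving a triangular system
    ([laurent_connection]). The coefficient along P_(m-j) is the j-th moment. It
    is thus a polynomial, independent of m and of the measure, in finitely many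
    bounded quantities whose differences for the two measures tend to 0.

    The measures enter only through the form (f, g) |-> int f conj(g), for which
    multiplication by z is bounded by the radius of the support
    ([bounded_L2form]), because the complement of the support is a null set. *)

(** * The trace of multiplication modulo a polynomial *)

Section ModularTrace.
Variable F : fieldType.
Implicit Types (Q h : {poly F}) (b : nat -> {poly F}).

(** Both sides are the trace of multiplication by h on F[X]/(Q), in the basis b
    and in the monomial basis. The change of basis is triangular, with the
    leading coefficients of the b k on its diagonal. *)
Lemma modular_trace n Q h b (c : 'M[F]_n) :
  (forall k, size (b k) = k.+1) ->
  (forall k : 'I_n, (h * b k) %% Q = \sum_(i < n) c k i *: b i) ->
  \tr c = \tr (\matrix_(i < n, k < n) ((h * 'X^i) %% Q)`_k).
Proof.
move=> sb hc; set A := (X in _ = \tr X).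
pose T : 'M[F]_n := \matrix_(k, i) (b k)`_i.
have uT : T \in unitmx.
  rewrite unitmxE det_trig; last first.
    apply/is_trig_mxP => i j ij.
    by rewrite mxE nth_default // sb.
  rewrite unitfE; apply/prodf_neq0 => i _; rewrite mxE.
  by rewrite -[X in _`_X]/(i.+1.-1) -{1}(sb i) -lead_coefE lead_coef_eq0 -size_poly_eq0 sb.
have TA : T *m A = c *m T.
  apply/matrixP => k j; rewrite !mxE.
  transitivity (((h * b k) %% Q)`_j); last first.
    by rewrite hc coef_sum; apply: eq_bigr => i _; rewrite coefZ !mxE.
  have bE : b k = \sum_(i < n) (b k)`_i *: 'X^i.
    rewrite -poly_def; apply/polyP => i; rewrite coef_poly.
    by case: ltnP => // ni; rewrite nth_default // sb; exact: leq_trans (ltn_ord k) ni.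
  rewrite [in RHS]bE mulr_sumr.
  rewrite (big_morph (fun g => g %% Q) (modpD _) (mod0p _)) coef_sum.
  by apply: eq_bigr => i _; rewrite !mxE -scalerAr modpZl coefZ.
by rewrite -[c](mulmxK uT) -TA -mulmxA mxtrace_mulC -mulmxA mulVmx // mulmx1.
Qed.

(** In the Newton basis prod_(i < k) (X - zs i), multiplication by X is
    bidiagonal with the zs i on its diagonal, so multiplication by X^j is
    triangular with their powers there. *)
Lemma trace_roots n (zs : nat -> F) j :
  let Q := \prod_(i < n) ('X - (zs i)%:P) in
  \tr (\matrix_(i < n, k < n) (('X^j * 'X^i) %% Q)`_k) = \sum_(i < n) zs i ^+ j.
Proof.
move=> Q; pose b k := \prod_(i < k) ('X - (zs i)%:P).
have sb k : size (b k) = k.+1.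
  by rewrite /b size_prod_XsubC /index_enum -enumT size_enum_ord.
have bS k : 'X * b k = b k.+1 + zs k *: b k.
  by rewrite /b big_ord_recr /= mulrBr [_ * _%:P]mulrC mul_polyC subrK mulrC.
have [c cE] : exists c : nat -> nat -> F, forall k, (k < n)%N ->
   [/\ ('X^j * b k) %% Q = \sum_(i < n) c k i *: b i, c k k = zs k ^+ j &
       forall i, (i < k)%N -> c k i = 0].
  elim: {+}j => [|i [c IH]].
    exists (fun k i => (k == i)%:R) => k kn; split; rewrite ?eqxx //.
    - rewrite expr0 mul1r modp_small ?(sb n) ?sb //.
      rewrite (bigD1 (Ordinal kn)) //= eqxx scale1r big1 ?addr0 // => i ik.
      by rewrite eq_sym -[k]/(val (Ordinal kn)) val_eqE (negPf ik) scale0r.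
    - by move=> i ik; rewrite gtn_eqF.
  exists (fun k l => c k l * zs l + (if l is l'.+1 then c k l' else 0)) => k kn.
  have [cE ck c0] := IH _ kn; split.
  - rewrite exprS -mulrA -modp_mul cE mulr_sumr.
    rewrite (big_morph (fun g => g %% Q) (modpD _) (mod0p _)).
    under eq_bigr => l _ do rewrite -scalerAr bS modpZl modpD modpZl scalerDr.
    under [RHS]eq_bigr => l _ do rewrite scalerDl -scalerA.
    rewrite !big_split /= addrC; congr (_ + _).
      by apply: eq_bigr => l _; rewrite modp_small // ?(sb n) sb ltnS.
    have : Q = b n by [].
    move: (Q) cE kn; case: (n) => [//|m] Q' cE kn ->.
    rewrite big_ord_recr big_ord_recl /= modpp scaler0 addr0 scale0r add0r.
    apply: eq_bigr => l _; rewrite modp_small // !sb ltnS.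
    exact: ltn_ord.
  - by rewrite ck exprSr; case: k {kn cE ck} c0 => [|k] c0; rewrite ?c0 ?addr0.
  - case=> [|l] lk; first by rewrite c0 // mul0r addr0.
    by rewrite !c0 ?mul0r ?addr0 // ltnW.
rewrite -(modular_trace (c := \matrix_(k, i) c k i) sb) => [|k].
  by apply: eq_bigr => k _; rewrite mxE; case: (cE k (ltn_ord k)).
by have [-> _ _] := cE k (ltn_ord k); apply: eq_bigr => i _; rewrite mxE.
Qed.
End ModularTrace.

(** * Orthogonal polynomials of a form with bounded multiplication *)

(** The inner product of L2(mu), reduced to what the algebra needs: the last
    field says that multiplication by X has norm at most rho. *)
Record bounded_form (C : numClosedFieldType)
    (B : {poly C} -> {poly C} -> C) (rho : C) : Prop := BoundedForm {
  form_linear : forall a f g h, B (a *: f + g) h = a * B f h + B g h;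
  form_conj : forall f g, B g f = (B f g)^*;
  form_ge0 : forall f, 0 <= B f f;
  form_radius_ge0 : 0 <= rho;
  form_X : forall f, B ('X * f) ('X * f) <= rho ^+ 2 * B f f }.

Record monic_orthogonal (C : numClosedFieldType)
    (B : {poly C} -> {poly C} -> C) (P : nat -> {poly C}) : Prop :=
  MonicOrthogonal {
  ortho_monic : forall n, P n \is monic;
  ortho_size : forall n, size (P n) = n.+1;
  ortho_neq : forall n m, n != m -> B (P n) (P m) = 0;
  ortho_gt0 : forall n, 0 < B (P n) (P n) }.

Section Form.
Variables (C : numClosedFieldType) (B : {poly C} -> {poly C} -> C) (rho : C).
Hypothesis hB : bounded_form B rho.

Lemma form0l h : B 0 h = 0.
Proof.
by have := form_linear hB (-1) h h h; rewrite scaleN1r addNr mulN1r addNr.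
Qed.
Lemma formZl a f h : B (a *: f) h = a * B f h.
Proof. by rewrite -[a *: f]addr0 (form_linear hB) form0l addr0. Qed.
Lemma formDl f g h : B (f + g) h = B f h + B g h.
Proof. by rewrite -[f in LHS]scale1r (form_linear hB) mul1r. Qed.
Lemma formDr f g h : B h (f + g) = B h f + B h g.
Proof. by rewrite !(form_conj hB _ h) formDl rmorphD. Qed.
Lemma formZr a f h : B h (a *: f) = a^* * B h f.
Proof. by rewrite !(form_conj hB _ h) formZl rmorphM. Qed.
Lemma formBl f g h : B (f - g) h = B f h - B g h.
Proof. by rewrite -scaleN1r formDl formZl mulN1r. Qed.
Lemma formBr f g h : B h (f - g) = B h f - B h g.
Proof. by rewrite !(form_conj hB _ h) formBl rmorphB. Qed.
Lemma form_suml I (r : seq I) (F : I -> {poly C}) h :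
  B (\sum_(i <- r) F i) h = \sum_(i <- r) B (F i) h.
Proof. by apply: (big_morph (B^~ h)) => [f g|]; rewrite (formDl, form0l). Qed.
Lemma form_normZ a f : B (a *: f) (a *: f) = `|a| ^+ 2 * B f f.
Proof. by rewrite formZl formZr normCK mulrA. Qed.
(** A square-root-free substitute for the triangle inequality. It costs a
    constant factor, harmless because only large z matter. *)
Lemma form_le2D f g : B (f + g) (f + g) <= 2 * (B f f + B g g).
Proof.
have := form_ge0 hB (f - g).
rewrite !formBl !formBr !formDl !formDr => h; rewrite -subr_ge0.
by move: h; congr (0 <= _); ring.
Qed.
Lemma form_Xn j f :
  B ('X^j * f) ('X^j * f) <= (rho ^+ j) ^+ 2 * B f f.
Proof.
elim: j => [|j IH]; first by rewrite expr0 expr1n !mul1r.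
rewrite exprS -mulrA; apply: le_trans (form_X hB _) _.
by rewrite [rho ^+ j.+1]exprS exprMn -[leRHS]mulrA ler_wpM2l // 
  exprn_ge0 ?(form_radius_ge0 hB).
Qed.

Variable P : nat -> {poly C}.
Hypothesis hP : monic_orthogonal B P.

(** The normalisation makes it the coefficient along P_k in the expansion of f in
    the monic basis. *)
Definition ocoef (f : {poly C}) (k : nat) : C := B f (P k) / B (P k) (P k).

Lemma ocoefD f g k : ocoef (f + g) k = ocoef f k + ocoef g k.
Proof. by rewrite /ocoef formDl mulrDl. Qed.
Lemma ocoefZ a f k : ocoef (a *: f) k = a * ocoef f k.
Proof. by rewrite /ocoef formZl mulrA. Qed.
Lemma ocoef_sum I (r : seq I) (F : I -> {poly C}) k :
  ocoef (\sum_(i <- r) F i) k = \sum_(i <- r) ocoef (F i) k.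
Proof. by rewrite /ocoef form_suml mulr_suml. Qed.
Lemma ortho_form_neq0 n : B (P n) (P n) != 0.
Proof. by rewrite gt_eqF ?(ortho_gt0 hP). Qed.
Lemma ocoef_ortho m k : ocoef (P m) k = (m == k)%:R.
Proof.
rewrite /ocoef; case: eqVneq => [->|/(ortho_neq hP) ->]; last by rewrite mul0r.
by rewrite divff // ortho_form_neq0.
Qed.

Lemma ortho_coef n : (P n)`_n = 1.
Proof. by have /monicP := ortho_monic hP n; rewrite /lead_coef (ortho_size hP). Qed.
Lemma ortho_neq0 n : P n != 0.
Proof. by rewrite -size_poly_eq0 (ortho_size hP). Qed.

Lemma size_drop_lead n (f : {poly C}) :
  (size f <= n.+1)%N -> (size (f - f`_n *: P n)%R <= n)%N.
Proof.
move=> sf; apply/leq_sizeP => j; rewrite leq_eqVlt => /orP[/eqP <-|nj].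
  by rewrite coefB coefZ ortho_coef mulr1 subrr.
have fj : f`_j = 0 by rewrite nth_default // (leq_trans sf).
by rewrite coefB coefZ fj [(P n)`__]nth_default ?mulr0 ?subrr // (ortho_size hP).
Qed.

Lemma ortho_span n (f : {poly C}) :
  (size f <= n)%N -> exists c : nat -> C, f = \sum_(k < n) c k *: P k.
Proof.
elim: n f => [|n IH] f sf.
  by exists (fun=> 0); rewrite big_ord0; apply/eqP; rewrite -size_poly_leq0.
have [c cE] := IH _ (size_drop_lead sf).
exists (fun k => if k == n then f`_n else c k).
rewrite big_ord_recr /= eqxx -[LHS](subrK (f`_n *: P n)); congr (_ + _).
by rewrite {1}cE; apply: eq_bigr => k _; rewrite ltn_eqF.
Qed.

Lemma ocoefE n (f : {poly C}) : (size f <= n)%N -> f = \sum_(k < n) ocoef f k *: P k.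
Proof.
case/ortho_span => c ->; apply: eq_bigr => k _; congr (_ *: _).
rewrite ocoef_sum (bigD1 k) //= ocoefZ ocoef_ortho eqxx mulr1 big1 ?addr0 //.
by move=> i /negPf ik; rewrite ocoefZ ocoef_ortho val_eqE ik mulr0.
Qed.

Lemma ocoef_eq0 n (f : {poly C}) : (size f <= n)%N -> ocoef f n = 0.
Proof.
move=> sf; rewrite (ocoefE sf) ocoef_sum big1 // => k _.
by rewrite ocoefZ ocoef_ortho ltn_eqF ?mulr0.
Qed.

Lemma ocoef_lead n (f : {poly C}) : (size f <= n.+1)%N -> ocoef f n = f`_n.
Proof.
move=> sf; rewrite -[f in LHS](subrK (f`_n *: P n)) ocoefD ocoefZ ocoef_ortho.
by rewrite eqxx mulr1 ocoef_eq0 ?add0r // size_drop_lead.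
Qed.

Lemma form_pythagoras f k :
  B f f = B (f - ocoef f k *: P k) (f - ocoef f k *: P k)
          + `|ocoef f k| ^+ 2 * B (P k) (P k).
Proof.
set c := ocoef f k; set N := B (P k) (P k).
have fP : B f (P k) = c * N by rewrite /c /ocoef divfK // ortho_form_neq0.
have Pf : B (P k) f = c^* * N.
  rewrite (form_conj hB f) fP rmorphM /=; congr (_ * _).
  by rewrite /N -(form_conj hB).
rewrite formBl !formBr !formZl !formZr fP Pf normCK -/N; ring.
Qed.

Lemma ocoef_bessel (f : {poly C}) k : `|ocoef f k| ^+ 2 * B (P k) (P k) <= B f f.
Proof. by rewrite [leRHS](form_pythagoras f k) lerDr (form_ge0 hB). Qed.

(** Reduction modulo P_n is here the orthogonal projection onto degree less than
    n: this turns computations modulo P_n into norm estimates. *)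
Lemma modp_ortho n (f : {poly C}) :
  (size f <= n.+1)%N -> f %% P n = f - f`_n *: P n.
Proof.
move=> sf; rewrite -[f in LHS](subrK (f`_n *: P n)) modpD.
rewrite modpZl modpp scaler0 addr0.
by rewrite modp_small // (ortho_size hP) ltnS size_drop_lead.
Qed.

Definition Xn_mod n i (f : {poly C}) : {poly C} := ('X^i * f) %% P n.
(** The coefficient of z^(-i-1) in the expansion at infinity of f / P_(n+1). *)
Definition laurent n f i : C := (Xn_mod n.+1 i f)`_n.

Lemma size_Xn_mod n i f : (size (Xn_mod n i f) <= n)%N.
Proof. by rewrite -ltnS -(ortho_size hP n) ltn_modp ortho_neq0. Qed.

Lemma Xn_modS n i f : Xn_mod n i.+1 f = ('X * Xn_mod n i f) %% P n.
Proof. by rewrite /Xn_mod exprS -mulrA modp_mul. Qed.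

Lemma Xn_modSE n i f :
  Xn_mod n.+1 i.+1 f = 'X * Xn_mod n.+1 i f - laurent n f i *: P n.+1.
Proof.
have sX : (size ('X * Xn_mod n.+1 i f)%R <= n.+2)%N.
  by rewrite (leq_trans (size_polyMleq _ _)) // size_polyX ltnS size_Xn_mod.
by rewrite Xn_modS modp_ortho // coefXM.
Qed.

(** Each step is a multiplication by X followed by an orthogonal projection. *)
Lemma form_Xn_mod n i (f : {poly C}) : (size f <= n)%N ->
  B (Xn_mod n i f) (Xn_mod n i f) <= (rho ^+ i) ^+ 2 * B f f.
Proof.
move=> sf; elim: i => [|i IH].
  by rewrite /Xn_mod expr0 expr1n !mul1r modp_small // (ortho_size hP).
have sX : (size ('X * Xn_mod n i f)%R <= n.+1)%N.
  by rewrite (leq_trans (size_polyMleq _ _)) // size_polyX ltnS size_Xn_mod.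
rewrite Xn_modS modp_ortho // -ocoef_lead //.
apply: (@le_trans _ _ (B ('X * Xn_mod n i f) ('X * Xn_mod n i f))).
  rewrite [leRHS](form_pythagoras _ n) lerDl mulr_ge0 ?exprn_ge0 //.
  exact: form_ge0 hB _.
apply: le_trans (form_X hB _) _.
by rewrite [rho ^+ i.+1]exprS exprMn -[leRHS]mulrA ler_wpM2l // 
  exprn_ge0 ?(form_radius_ge0 hB).
Qed.

Lemma norm_laurent_ortho n i : `|laurent n (P n) i| <= rho ^+ i.
Proof.
rewrite -ler_sqr ?nnegrE ?exprn_ge0 ?(form_radius_ge0 hB) //.
rewrite -(ler_pM2r (ortho_gt0 hP n)) /laurent -ocoef_lead ?size_Xn_mod //.
by apply: le_trans (ocoef_bessel _ _) (form_Xn_mod _ _); rewrite (ortho_size hP).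
Qed.

Lemma norm_ocoef_Xn_mod n i k : (k < n)%N -> `|ocoef (Xn_mod n i (P k)) k| <= rho ^+ i.
Proof.
move=> kn; rewrite -ler_sqr ?nnegrE ?exprn_ge0 ?(form_radius_ge0 hB) //.
rewrite -(ler_pM2r (ortho_gt0 hP k)).
by apply: le_trans (ocoef_bessel _ _) (form_Xn_mod _ _); rewrite (ortho_size hP).
Qed.

(** For the form of L2(mu), this is the integral of z^j |p_k|^2 with p_k the
    orthonormal polynomial. *)
Definition moment j k : C := ocoef ('X^j * P k) k.

Lemma norm_moment j k : `|moment j k| <= rho ^+ j.
Proof.
rewrite -ler_sqr ?nnegrE ?exprn_ge0 ?(form_radius_ge0 hB) //.
rewrite -(ler_pM2r (ortho_gt0 hP k)).
by apply: le_trans (ocoef_bessel _ _) (form_Xn _ _).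
Qed.

(** With g = (f(z) P_(n+1) - P_(n+1)(z) f) / (X - z), one has
    z g = (X g mod P_(n+1)) + P_(n+1)(z) f. Thus g is, up to the factor
    P_(n+1)(z), the resolvent at z of the compression applied to f, and its norm
    is controlled when |z| is large; its coefficient of X^n is f(z). *)
Lemma form_resolvent n (f : {poly C}) (z : C) : (size f <= n.+1)%N ->
  4 * rho ^+ 2 <= `|z| ^+ 2 ->
  `|z| ^+ 2 * (`|f.[z]| ^+ 2 * B (P n) (P n))
    <= 4 * (`|(P n.+1).[z]| ^+ 2 * B f f).
Proof.
move=> sf hz.
pose h := f.[z] *: P n.+1 - (P n.+1).[z] *: f.
have hz0 : root h z by rewrite /root !hornerE mulrC subrr.
have /factor_theorem [g hg] := hz0.
have sh : (size h <= n.+2)%N.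
  rewrite (leq_trans (size_polyD _ _)) // geq_max size_polyN.
  rewrite (leq_trans (size_scale_leq _ _)) ?(ortho_size hP) //.
  by rewrite (leq_trans (size_scale_leq _ _)) // (leq_trans sf).
have sg : (size g <= n.+1)%N.
  have [->|g0] := eqVneq g 0; first by rewrite size_poly0.
  by move: sh; rewrite hg size_Mmonic ?monicXsubC // size_XsubC addn2.
have gn : g`_n = f.[z].
  have : h`_n.+1 = f.[z].
    by rewrite coefB !coefZ ortho_coef mulr1 [f`__]nth_default // mulr0 subr0.
  rewrite hg mulrBr coefB coefMX coefMC /= [g`_n.+1]nth_default //.
  by rewrite mul0r subr0.
have hXg : 'X * g = h + z *: g.
  by rewrite hg mulrBr [g * z%:P]mulrC mul_polyC subrK mulrC.
have sXg : (size ('X * g)%R <= n.+2)%N.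
  by rewrite (leq_trans (size_polyMleq _ _)) // size_polyX ltnS.
have zg : z *: g = ('X * g) %% P n.+1 + (P n.+1).[z] *: f.
  by rewrite modp_ortho // coefXM /= gn hXg /h; ring.
have lez : `|z| ^+ 2 * B g g <=
    2 * (rho ^+ 2 * B g g + `|(P n.+1).[z]| ^+ 2 * B f f).
  rewrite -[leLHS]form_normZ zg; apply: le_trans (form_le2D _ _) _.
  rewrite ler_pM2l ?ltr0n // form_normZ lerD2r.
  by have := form_Xn_mod 1 sg; rewrite /Xn_mod !expr1.
(* Among polynomials of degree at most n with coefficient c at X^n, c P_n has
   least norm. *)
have leN : `|f.[z]| ^+ 2 * B (P n) (P n) <= B g g.
  by rewrite -gn -ocoef_lead // ocoef_bessel.
have Bg := form_ge0 hB g.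
apply: (@le_trans _ _ (`|z| ^+ 2 * B g g)).
  by rewrite ler_wpM2l ?exprn_ge0.
set N := `|(P n.+1).[z]| ^+ 2 * B f f in lez *.
have hzg : 4 * rho ^+ 2 * B g g <= `|z| ^+ 2 * B g g by rewrite ler_wpM2r.
rewrite -(lerD2l (4 * rho ^+ 2 * B g g)) (le_trans (lerD hzg (lexx _))) //.
have -> : `|z| ^+ 2 * B g g + `|z| ^+ 2 * B g g = 2 * (`|z| ^+ 2 * B g g) by ring.
have -> : 4 * rho ^+ 2 * B g g + 4 * N = 2 * (2 * (rho ^+ 2 * B g g + N)) by ring.
by rewrite ler_pM2l ?ltr0n.
Qed.

Lemma ortho_horner_neq0 n (z : C) : z != 0 ->
  4 * rho ^+ 2 <= `|z| ^+ 2 -> (P n.+1).[z] != 0.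
Proof.
move=> z0 hz; apply/eqP => Pz.
have /form_resolvent /(_ hz) : (size (1 : {poly C})%R <= n.+1)%N by rewrite size_poly1.
rewrite Pz normr0 expr0n mul0r mulr0 hornerC normr1 expr1n mul1r.
by rewrite lt_geF // mulr_gt0 ?exprn_gt0 ?normr_gt0 ?(ortho_gt0 hP).
Qed.

(** The remainder of the expansion of P_n / P_(n+1) is O(1/z) uniformly in n. *)
Lemma norm_Xn_mod_horner n i (z : C) : z != 0 -> 4 * rho ^+ 2 <= `|z| ^+ 2 ->
  `|z| * `|(Xn_mod n.+1 i (P n)).[z] / (P n.+1).[z]| <= 2 * rho ^+ i.
Proof.
move=> z0 hz; have Pz := ortho_horner_neq0 n z0 hz.
rewrite normrM normfV mulrA ler_pdivrMr ?normr_gt0 //.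
rewrite -ler_sqr ?nnegrE ?mulr_ge0 ?exprn_ge0 ?(form_radius_ge0 hB) ?ler0n // !exprMn.
rewrite -(ler_pM2r (ortho_gt0 hP n)) -[leLHS]mulrA.
apply: le_trans (form_resolvent (size_Xn_mod _ _ _) hz) _.
have := @form_Xn_mod n.+1 i (P n); rewrite (ortho_size hP) => /(_ (leqnn _)).
set T := B (Xn_mod _ _ _) _; set N := B (P n) (P n); set p := `|_| ^+ 2 => hT.
have -> : 2 ^+ 2 * (rho ^+ i) ^+ 2 * p * N = 4 * (p * ((rho ^+ i) ^+ 2 * N)) by ring.
by rewrite ler_pM2l ?ltr0n // ler_wpM2l // exprn_ge0.
Qed.

(** The Laurent expansion of P_n / P_(n+1), multiplied by z^j to make the
    coefficient of index j - 1 the constant term. *)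
Lemma ratio_expansion n j (z : C) : z != 0 -> (P n.+1).[z] != 0 ->
  z ^+ j * ((P n).[z] / (P n.+1).[z]) =
    \sum_(i < j) laurent n (P n) i * z ^+ (j - i.+1)
    + (Xn_mod n.+1 j (P n)).[z] / (P n.+1).[z].
Proof.
move=> z0 Pz; elim: j => [|j IH].
  by rewrite big_ord0 expr0 add0r mul1r /Xn_mod expr0 mul1r modp_small ?(ortho_size hP).
rewrite exprS -mulrA IH mulrDr big_ord_recr /= subnn expr0 mulr1 -addrA.
congr (_ + _).
  rewrite mulr_sumr; apply: eq_bigr => i _.
  by rewrite mulrCA -exprS subSn.
rewrite Xn_modSE !hornerE mulrBl mulfK //.
by rewrite addrC subrK /=.
Qed.

Lemma Xn_modD n i f g : Xn_mod n i (f + g) = Xn_mod n i f + Xn_mod n i g.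
Proof. by rewrite /Xn_mod mulrDr modpD. Qed.
Lemma Xn_modZ n i a f : Xn_mod n i (a *: f) = a *: Xn_mod n i f.
Proof. by rewrite /Xn_mod -scalerAr modpZl. Qed.
Lemma laurentD n i f g : laurent n (f + g) i = laurent n f i + laurent n g i.
Proof. by rewrite /laurent Xn_modD coefD. Qed.
Lemma laurentZ n i a f : laurent n (a *: f) i = a * laurent n f i.
Proof. by rewrite /laurent Xn_modZ coefZ. Qed.
Lemma laurent_sum n i I (r : seq I) (F : I -> {poly C}) :
  laurent n (\sum_(k <- r) F k) i = \sum_(k <- r) laurent n (F k) i.
Proof.
apply: (big_morph (fun f => laurent n f i)) => [f g|]; first exact: laurentD.
by rewrite -[0](scale0r 0) laurentZ mul0r.
Qed.
Lemma laurent_Xn n i j f : laurent n ('X^j * f) i = laurent n f (i + j).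
Proof. by rewrite /laurent /Xn_mod mulrA -exprD. Qed.

(** P_k / P_(n+1) is z^(k-n-1) (1 + O(1/z)). *)
Lemma laurent_small n k i : (k + i <= n)%N ->
  laurent n (P k) i = (k + i == n)%N%:R.
Proof.
move=> kin; rewrite /laurent /Xn_mod modp_small; last first.
  rewrite (ortho_size hP) (leq_ltn_trans (size_polyMleq _ _)) //.
  by rewrite size_polyXn (ortho_size hP); lia.
rewrite coefXnM; case: ltnP => [ni|ni].
  by case: eqP => //; lia.
have [kE|kN] := eqVneq; first by rewrite -kE addnK ortho_coef.
by rewrite nth_default // (ortho_size hP); lia.
Qed.

Lemma Xn_expansion n i (f : {poly C}) : (size f <= n.+1)%N ->
  'X^i * f = \sum_(s < i) laurent n f s *: ('X^(i - s.+1) * P n.+1)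
             + Xn_mod n.+1 i f.
Proof.
move=> sf; elim: i => [|i IH].
  by rewrite big_ord0 add0r /Xn_mod expr0 mul1r modp_small // (ortho_size hP).
rewrite exprS -mulrA IH mulrDr big_ord_recr /= subnn expr0 mul1r -addrA.
congr (_ + _); last by rewrite Xn_modSE addrC subrK.
rewrite mulr_sumr; apply: eq_bigr => s _.
by rewrite -scalerAr mulrA -exprS subSn.
Qed.

(** The expansion of f / P_(n+2) is the product of those of f / P_(n+1) and of
    P_(n+1) / P_(n+2). *)
Lemma laurent_convolution n i (f : {poly C}) : (size f <= n.+1)%N ->
  laurent n.+1 f i =
  \sum_(s < i) laurent n f s * laurent n.+1 (P n.+1) (i - s.+1).
Proof.
move=> sf; rewrite {1}/laurent {1}/Xn_mod (Xn_expansion i sf) modpD coefD.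
rewrite [X in _ + X]nth_default ?addr0; last first.
  rewrite modp_small ?size_Xn_mod // (ortho_size hP) (leq_ltn_trans (size_Xn_mod _ _ _)) //.
rewrite -/(Xn_mod _ _ _).
rewrite (big_morph (fun g => g %% P n.+2) (modpD _) (mod0p _)) coef_sum.
by apply: eq_bigr => s _; rewrite modpZl coefZ.
Qed.

(** Both sides are the coefficient of z^(-i-1) in X^j P_(m-j) / P_(m+1), the
    numerator being expanded along the P_(m-t) on the right. As P_(m-t) / P_(m+1)
    starts at z^(-t-1), only t <= i contribute, and the system is triangular in
    the coefficients of that expansion. *)
Lemma laurent_connection m j i : (i <= j)%N -> (j <= m)%N ->
  laurent m (P (m - j)) (i + j) =
  \sum_(t < i) ocoef ('X^j * P (m - j)) (m - t) * laurent m (P (m - t)) i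
  + ocoef ('X^j * P (m - j)) (m - i).
Proof.
move=> ij jm; set f := 'X^j * _.
have sf : (size f <= m.+1)%N.
  rewrite (leq_trans (size_polyMleq _ _)) // size_polyXn (ortho_size hP); lia.
rewrite -laurent_Xn -/f {1}(ocoefE sf) laurent_sum.
pose F k := ocoef f k * laurent m (P k) i.
rewrite (eq_bigr (fun k : 'I_m.+1 => F k)); last by move=> k _; rewrite laurentZ.
rewrite -(big_mkord xpredT F) big_rev_mkord subn0 /=.
have im : (i < m.+1)%N by lia.
rewrite -(big_mkord xpredT (fun t => F (m.+1 - t.+1)%N)).
rewrite (@big_cat_nat _ _ _ i.+1) //= big_nat_recr //= big_mkord.
rewrite [X in _ + X]big_nat_cond [X in _ + X]big1 ?addr0 => [|t]; last first.
  rewrite andbT => /andP[it tm]; rewrite /F laurent_small; last by lia.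
  by case: eqP => [|_]; [lia | rewrite mulr0].
rewrite /F subSS laurent_small; last by lia.
rewrite subnK ?eqxx ?mulr1 //; lia.
Qed.

(** The reduction modulo P_n has no effect here, by degree. *)
Lemma Xn_mod_moment n j k : (k + j < n)%N ->
  ocoef (Xn_mod n j (P k)) k = moment j k.
Proof.
move=> kjn; rewrite /Xn_mod modp_small // (ortho_size hP).
rewrite (leq_ltn_trans (size_polyMleq _ _)) // size_polyXn (ortho_size hP); lia.
Qed.

Lemma sum_roots_ocoef n j (zs : nat -> C) :
  P n = \prod_(i < n) ('X - (zs i)%:P) ->
  \sum_(i < n) zs i ^+ j = \sum_(k < n) ocoef (Xn_mod n j (P k)) k.
Proof.
move=> PE; rewrite -trace_roots -PE.
rewrite -(modular_trace (c := \matrix_(k, i) ocoef (Xn_mod n j (P k)) i)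
  (ortho_size hP)) => [|k].
  by apply: eq_bigr => k _; rewrite mxE.
rewrite -/(Xn_mod n j _) {1}(ocoefE (size_Xn_mod n j (P k))).
by apply: eq_bigr => i _; rewrite mxE.
Qed.

(** Only the last j diagonal entries of the trace feel the reduction modulo P_n,
    and each of them, like each moment, is at most rho^j. *)
Lemma sum_roots_moments n j (zs : nat -> C) :
  P n = \prod_(i < n) ('X - (zs i)%:P) ->
  `|\sum_(i < n) zs i ^+ j - \sum_(k < n) moment j k| <= rho ^+ j *+ 2 *+ j.
Proof.
move=> /(sum_roots_ocoef j) ->; rewrite -sumrB.
apply: le_trans (ler_norm_sum _ _ _) _.
have rho0 : 0 <= rho ^+ j *+ 2 by rewrite mulrn_wge0 ?exprn_ge0 ?(form_radius_ge0 hB).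
rewrite -(big_mkord xpredT (fun k => `|ocoef (Xn_mod n j (P k)) k - moment j k|)).
rewrite (@big_cat_nat _ _ _ (n - j)) ?leq_subr //=.
rewrite [X in X + _]big_nat [X in X + _]big1 ?add0r; last first.
  move=> k /andP[_ kn]; rewrite Xn_mod_moment ?subrr ?normr0 //; lia.
rewrite big_nat (@le_trans _ _ (\sum_(n - j <= k < n) rho ^+ j *+ 2)) //.
  rewrite [leRHS]big_nat ler_sum // => k /andP[_ kn].
  apply: le_trans (ler_normB _ _) _.
  by rewrite mulr2n lerD // ?norm_ocoef_Xn_mod ?norm_moment.
by rewrite sumr_const_nat; apply: ler_wpMn2l => //; lia.
Qed.

End Form.

(** * Pairs of sequences with null difference up to a shift *)

Section ShiftEquivalence.
Variable K : numFieldType.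
Implicit Types u v w : nat -> K.

Lemma null_seqP w : w n @[n --> \oo] --> (0 : K^o) <->
  forall e : K, 0 < e -> exists N, forall n, (N <= n)%N -> `|w n| < e.
Proof.
split=> [/cvgr0Pnorm_lt h e e0|h].
  by have [N _ hN] := h e e0; exists N => n; apply: hN.
by apply/cvgr0Pnorm_lt => e /h [N hN]; exists N.
Qed.

Lemma null_seq_eq N w w' : (forall n, (N <= n)%N -> w n = w' n) ->
  w n @[n --> \oo] --> (0 : K^o) -> w' n @[n --> \oo] --> (0 : K^o).
Proof.
move=> ww' /null_seqP w0; apply/null_seqP => e /w0 [N' hN].
exists (maxn N N') => n; rewrite geq_max => /andP[nN nN'].
by rewrite -ww' // hN.
Qed.

Lemma null_seq_bound N (M : K) w b : (forall n, (N <= n)%N -> `|b n| <= M) ->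
  w n @[n --> \oo] --> (0 : K^o) -> b n * w n @[n --> \oo] --> (0 : K^o).
Proof.
move=> bM /null_seqP w0; apply/null_seqP => e e0.
have M0 : 0 < M + 1.
  by rewrite ltr_wpDl // (le_trans _ (bM N (leqnn N))).
have [N' hN] := w0 _ (divr_gt0 e0 M0).
exists (maxn N N') => n; rewrite geq_max => /andP[nN nN'].
rewrite normrM (@le_lt_trans _ _ ((M + 1) * `|w n|)) //.
  by rewrite ler_wpM2r // (le_trans (bM n nN)) // lerDl.
by rewrite mulrC -ltr_pdivlMr // hN.
Qed.

Lemma null_seqD w w' :
  w n @[n --> \oo] --> (0 : K^o) -> w' n @[n --> \oo] --> (0 : K^o) ->
  w n + w' n @[n --> \oo] --> (0 : K^o).
Proof. by move=> h h'; rewrite -[0 : K^o]addr0; exact: cvgD h h'. Qed.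

Lemma null_seqN w :
  w n @[n --> \oo] --> (0 : K^o) -> - w n @[n --> \oo] --> (0 : K^o).
Proof. by move=> h; rewrite -[0 : K^o]oppr0; exact: cvgN h. Qed.

Lemma null_seq_sum (w : nat -> nat -> K) m :
  (forall k, (k < m)%N -> w k n @[n --> \oo] --> (0 : K^o)) ->
  \sum_(k < m) w k n @[n --> \oo] --> (0 : K^o).
Proof.
elim: m => [|m IH] h.
  by under eq_fun do rewrite big_ord0; exact: cvg_cst.
under eq_fun do rewrite big_ord_recr /=.
have hm : \sum_(k < m) w k n @[n --> \oo] --> (0 : K^o).
  by apply: IH => k km; apply: h; exact: ltnW.
exact: null_seqD hm (h m (ltnSn m)).
Qed.

(** Boundedness is included to make the relation compatible with products. *)
Record shift_equiv (l : nat) u v : Prop := ShiftEquiv {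
  shift_equiv_bound : exists N (M : K), forall n, (N <= n)%N ->
    `|u n| <= M /\ `|v n| <= M;
  shift_equiv_lim : u n - v (n - l)%N @[n --> \oo] --> (0 : K^o) }.

Variable l : nat.

Lemma shift_equiv_eq N u v u' v' :
  (forall n, (N <= n)%N -> u n = u' n /\ v n = v' n) ->
  shift_equiv l u v -> shift_equiv l u' v'.
Proof.
move=> e [[N' [M hM]] h]; split.
  exists (maxn N N'), M => n; rewrite geq_max => /andP[/e [<- <-]]; exact: hM.
apply: (null_seq_eq (N := N + l)) h => n nN.
have [nN1 nN2] : (N <= n)%N /\ (N <= n - l)%N by split; lia.
by have [-> _] := e n nN1; have [_ ->] := e _ nN2.
Qed.

Lemma shift_equiv_cst c : shift_equiv l (fun=> c) (fun=> c).
Proof.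
split; first by exists 0%N, `|c|.
by under eq_fun do rewrite subrr; exact: cvg_cst.
Qed.

Lemma shift_equivB u v u' v' : shift_equiv l u v -> shift_equiv l u' v' ->
  shift_equiv l (fun n => u n - u' n) (fun n => v n - v' n).
Proof.
move=> [[N [M hM]] h] [[N' [M' hM']] h']; split.
  exists (maxn N N'), (M + M') => n; rewrite geq_max => /andP[/hM [? ?] /hM' [? ?]].
  by split; apply: le_trans (ler_normB _ _) _; apply: lerD.
by apply: (null_seq_eq (N := 0)) (null_seqD h (null_seqN h')) => // n _; ring.
Qed.

Lemma shift_equivM u v u' v' : shift_equiv l u v -> shift_equiv l u' v' ->
  shift_equiv l (fun n => u n * u' n) (fun n => v n * v' n).
Proof.
move=> [[N [M hM]] h] [[N' [M' hM']] h']; split.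
  exists (maxn N N'), (M * M') => n; rewrite geq_max => /andP[/hM [? ?] /hM' [? ?]].
  by split; rewrite normrM ler_pM.
have h1 := null_seq_bound (N := N) (fun n nN => proj1 (hM n nN)) h'.
have h2 : v' (n - l)%N * (u n - v (n - l)%N) @[n --> \oo] --> (0 : K^o).
  apply: (null_seq_bound (N := N' + l) (M := M')) h => n nN.
  by have [] := hM' (n - l)%N; first by lia.
by apply: (null_seq_eq (N := 0)) (null_seqD h1 h2) => // n _; ring.
Qed.

Lemma shift_equiv_sum (u v : nat -> nat -> K) m :
  (forall k, (k < m)%N -> shift_equiv l (u k) (v k)) ->
  shift_equiv l (fun n => \sum_(k < m) u k n) (fun n => \sum_(k < m) v k n).
Proof.
elim: m => [|m IH] h.
  by under eq_fun do rewrite big_ord0; under [X in shift_equiv l _ X]eq_fun do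
    rewrite big_ord0; exact: shift_equiv_cst.
have hm : shift_equiv l (fun n => \sum_(k < m) u k n) (fun n => \sum_(k < m) v k n).
  by apply: IH => k km; apply: h; exact: ltnW.
have h0 := shift_equivB (shift_equiv_cst 0) (h m (ltnSn m)).
apply: (shift_equiv_eq (N := 0)) (shift_equivB hm h0) => n _.
by rewrite !big_ord_recr /=; split; ring.
Qed.

Lemma shift_equiv_pred u v : shift_equiv l u v ->
  shift_equiv l (fun n => u n.-1) (fun n => v n.-1).
Proof.
move=> [[N [M hM]] /null_seqP h]; split.
  by exists N.+1, M => n nN; apply: hM; lia.
apply/null_seqP => e /h [N' hN]; exists N'.+1 => n nN.
have -> : (n - l).-1 = (n.-1 - l)%N by lia.
by apply: hN; lia.
Qed.

End ShiftEquivalence.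

(** * Cesaro means *)

Section CesaroMeans.
Variable K : numFieldType.
Hypothesis arch : forall x : K, 0 <= x -> exists n : nat, x <= n%:R.

Lemma bounded_div_null (M : K) (d : nat -> K) : (forall n, `|d n| <= M) ->
  n%:R^-1 * d n @[n --> \oo] --> (0 : K^o).
Proof.
move=> dM; have M0 : 0 <= M by apply: le_trans (dM 0%N).
apply/null_seqP => e e0; have [N hN] := arch (divr_ge0 M0 (ltW e0)).
exists N.+1 => n Nn; have n0 : 0 < n%:R :> K by rewrite ltr0n; lia.
rewrite normrM normfV normr_nat mulrC ltr_pdivrMr // (le_lt_trans (dM n)) //.
by rewrite mulrC -ltr_pdivrMr // (le_lt_trans hN) // ltr_nat.
Qed.

Lemma cesaro_null (w : nat -> K) : w n @[n --> \oo] --> (0 : K^o) ->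
  n%:R^-1 * \sum_(k < n) w k @[n --> \oo] --> (0 : K^o).
Proof.
move=> /null_seqP w0; apply/null_seqP => e e0.
have e20 : 0 < e / 2 by rewrite divr_gt0.
have [N hN] := w0 _ e20; pose A := \sum_(k < N) `|w k|.
have A0 : 0 <= A by rewrite sumr_ge0.
have hA m : `|\sum_(k < N + m) w k| <= A + m%:R * (e / 2).
  elim: m => [|m IH]; first by rewrite addn0 mul0r addr0 ler_norm_sum.
  rewrite addnS big_ord_recr /= (le_trans (ler_normD _ _)) //.
  rewrite -[m.+1%:R]natr1 mulrDl mul1r addrA lerD // ltW // hN //; exact: leq_addr.
have [n0 hn0] := arch (divr_ge0 A0 (ltW e20)).
exists (N + n0.+1)%N => n nN; have n_gt0 : 0 < n%:R :> K by rewrite ltr0n; lia.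
rewrite normrM normfV normr_nat mulrC ltr_pdivrMr //.
have [m nE] : exists m, n = (N + m)%N by exists (n - N)%N; lia.
have eE : e * n%:R = n%:R * (e / 2) + n%:R * (e / 2).
  by rewrite -mulrDr -mulrDl -mulr2n -[e *+ 2]mulr_natr mulfK // mulrC.
have := hA m; rewrite -nE => /le_lt_trans; apply; rewrite eE ltr_leD //.
  by rewrite -ltr_pdivrMr // (le_lt_trans hn0) // ltr_nat; lia.
by rewrite ler_wpM2r ?(ltW e20) // ler_nat; lia.
Qed.

(** Shifting by one step replaces the last term of the sum by a second copy of
    the first. *)
Lemma sum_shift_bound (m : nat -> K) (b : K) l n : (forall k, `|m k| <= b) ->
  `|\sum_(k < n) m (k - l)%N - \sum_(k < n) m k| <= b *+ 2 *+ l.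
Proof.
move=> mb; have b0 : 0 <= b by apply: le_trans (mb 0%N).
elim: l => [|l IH].
  by rewrite (eq_bigr (fun k : 'I_n => m k)) ?subrr ?normr0 // => k _; rewrite subn0.
rewrite -(subrK (\sum_(k < n) m (k - l)%N) (\sum_(k < n) m (k - l.+1)%N)) -addrA.
apply: le_trans (ler_normD _ _) _; rewrite [_ *+ l.+1]mulrSr [leLHS]addrC lerD //.
case: n {IH} => [|n]; first by rewrite !big_ord0 subrr normr0 mulrn_wge0.
rewrite big_ord_recl big_ord_recr /=.
rewrite (eq_bigr (fun k : 'I_n => m (k - l)%N)) => [|k _]; last first.
  by rewrite /bump /= add1n subSS.
rewrite [X in `|X - _|]addrC opprD addrACA subrr add0r.
by apply: le_trans (ler_normB _ _) _; rewrite mulr2n lerD.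
Qed.

Lemma cesaro_shift_null (l : nat) (m1 m2 s1 s2 : nat -> K) (b M1 M2 : K) :
  (forall k, `|m2 k| <= b) ->
  (forall n, `|s1 n - \sum_(k < n) m1 k| <= M1) ->
  (forall n, `|s2 n - \sum_(k < n) m2 k| <= M2) ->
  m1 n - m2 (n - l)%N @[n --> \oo] --> (0 : K^o) ->
  n%:R^-1 * s1 n - n%:R^-1 * s2 n @[n --> \oo] --> (0 : K^o).
Proof.
move=> m2b h1 h2 /cesaro_null h.
have h3 := bounded_div_null (sum_shift_bound l ^~ m2b).
have h4 := null_seqD (bounded_div_null h1) (null_seqN (bounded_div_null h2)).
apply: (null_seq_eq (N := 0)) (null_seqD h4 (null_seqD h h3)) => n _.
by rewrite sumrB; ring.
Qed.
End CesaroMeans.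

(** * From ratio asymptotics to moments *)

Section RelativeAsymptotics.
Variables (C : numClosedFieldType) (B1 B2 : {poly C} -> {poly C} -> C).
Variables (rho1 rho2 : C) (P Q : nat -> {poly C}) (l : nat).
Hypotheses (hB1 : bounded_form B1 rho1) (hB2 : bounded_form B2 rho2).
Hypotheses (hP : monic_orthogonal B1 P) (hQ : monic_orthogonal B2 Q).

(** After multiplication by z^(j+1) and removal of the coefficients of index less
    than j, which are handled by induction, the difference of the two ratios is
    the difference of the j-th coefficients up to an error O(1/|z|) that is
    uniform in n. Fixing z large and then letting n grow makes both small. *)
Lemma laurent_ortho_shift_equiv (M : C) : 0 <= M ->
  (forall z : C, M < `|z| ->
     (P n).[z] / (P n.+1).[z] - (Q (n - l)%N).[z] / (Q (n - l).+1).[z]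
       @[n --> \oo] --> (0 : C^o)) ->
  forall j, shift_equiv l (fun n => laurent P n (P n) j)
                          (fun n => laurent Q n (Q n) j).
Proof.
move=> M0 h; elim/ltn_ind => j IH; split.
  exists 0%N, (rho1 ^+ j + rho2 ^+ j) => n _; split.
    rewrite (le_trans (norm_laurent_ortho hB1 hP _ _)) // lerDl.
    by rewrite exprn_ge0 ?(form_radius_ge0 hB2).
  rewrite (le_trans (norm_laurent_ortho hB2 hQ _ _)) // lerDr.
  by rewrite exprn_ge0 ?(form_radius_ge0 hB1).
apply/null_seqP => e e0.
have r10 := form_radius_ge0 hB1; have r20 := form_radius_ge0 hB2.
pose K := 2 * rho1 ^+ j.+1 + 2 * rho2 ^+ j.+1.
have K0 : 0 <= K by rewrite addr_ge0 ?mulr_ge0 ?exprn_ge0.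
have [T T0 TE] : exists2 T, 0 <= T & T = K / (e / 2).
  by exists (K / (e / 2)); rewrite // mulr_ge0 // invr_ge0 divr_ge0 // ltW.
(* z exceeds M and twice both radii, for the estimates to apply, and K / (e / 2),
   for the remainders to be less than e / 2. *)
pose z := M + 2 * rho1 + 2 * rho2 + T + 1.
have s1 : 0 <= M + 2 * rho1 + 2 * rho2 + T.
  by rewrite !addr_ge0 ?mulr_ge0.
have z0 : 0 < z by rewrite ltr_wpDl.
have zN0 : z != 0 by rewrite gt_eqF.
have zE : `|z| = z by rewrite gtr0_norm.
have Mz : M < `|z|.
  rewrite zE; have -> : z = M + (2 * rho1 + 2 * rho2 + T + 1).
    by rewrite /z; ring.
  by rewrite ltrDl ltr_wpDl // !addr_ge0 ?mulr_ge0.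
have r1z : 4 * rho1 ^+ 2 <= `|z| ^+ 2.
  have -> : 4 * rho1 ^+ 2 = (2 * rho1) ^+ 2 by ring.
  rewrite zE ler_sqr ?nnegrE ?mulr_ge0 ?(ltW z0) //.
  have -> : z = 2 * rho1 + (M + 2 * rho2 + T + 1) by rewrite /z; ring.
  by rewrite lerDl !addr_ge0 ?mulr_ge0.
have r2z : 4 * rho2 ^+ 2 <= `|z| ^+ 2.
  have -> : 4 * rho2 ^+ 2 = (2 * rho2) ^+ 2 by ring.
  rewrite zE ler_sqr ?nnegrE ?mulr_ge0 ?(ltW z0) //.
  have -> : z = 2 * rho2 + (M + 2 * rho1 + T + 1) by rewrite /z; ring.
  by rewrite lerDl !addr_ge0 ?mulr_ge0.
pose E1 n := (Xn_mod P n.+1 j.+1 (P n)).[z] / (P n.+1).[z].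
pose E2 n := (Xn_mod Q n.+1 j.+1 (Q n)).[z] / (Q n.+1).[z].
have EK n m : `|E1 n - E2 m| < e / 2.
  apply: (@le_lt_trans _ _ (K / z)).
    rewrite ler_pdivlMr // mulrC -{1}zE.
    apply: le_trans (ler_wpM2l (normr_ge0 _) (ler_normB _ _)) _.
    rewrite mulrDr lerD // ?(norm_Xn_mod_horner hB1 hP) //.
    exact: (norm_Xn_mod_horner hB2 hQ).
  rewrite ltr_pdivrMr // mulrC -ltr_pdivrMr ?divr_gt0 // -TE /z.
  have -> : M + 2 * rho1 + 2 * rho2 + T + 1
    = T + (M + 2 * rho1 + 2 * rho2 + 1) by ring.
  by rewrite ltrDl ltr_wpDl // !addr_ge0 ?mulr_ge0.
pose a i n := laurent P n (P n) i; pose b i n := laurent Q n (Q n) i.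
pose D n := (P n).[z] / (P n.+1).[z] - (Q (n - l)%N).[z] / (Q (n - l).+1).[z].
pose w n := z ^+ j.+1 * D n
   - \sum_(i < j) z ^+ (j.+1 - i.+1) * (a i n - b i (n - l)%N).
have w0 : w n @[n --> \oo] --> (0 : C^o).
  apply: null_seqD; first exact: (null_seq_bound (N := 0) (M := `|z ^+ j.+1|)) (h z Mz).
  apply: null_seqN; apply: (@null_seq_sum _
    (fun i n => z ^+ (j.+1 - i.+1) * (a i n - b i (n - l)%N))) => k kj.
  apply: (null_seq_bound (N := 0) (M := `|z ^+ (j.+1 - k.+1)|)) => //.
  by have [] := IH k kj.
have wE n : w n = (a j n - b j (n - l)%N) + (E1 n - E2 (n - l)%N).
  rewrite /w /D mulrBr.
  rewrite (ratio_expansion hP) ?(ratio_expansion hQ) //;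
    try exact: (ortho_horner_neq0 hB1 hP); try exact: (ortho_horner_neq0 hB2 hQ).
  rewrite !big_ord_recr /= subnn expr0 !mulr1 -/(E1 n) -/(E2 _).
  rewrite [\sum_(i < j) z ^+ _ * _](eq_bigr (fun i : 'I_j =>
    a i n * z ^+ (j.+1 - i.+1) - b i (n - l)%N * z ^+ (j.+1 - i.+1))).
    by rewrite sumrB /a /b; ring.
  by move=> i _; ring.
have e20 : 0 < e / 2 by rewrite divr_gt0.
have [N hN] := (null_seqP w).1 w0 _ e20.
exists N => n nN; rewrite -/(a j n) -/(b j _).
have -> : a j n - b j (n - l)%N = w n - (E1 n - E2 (n - l)%N).
  by rewrite wE addrK.
apply: le_lt_trans (ler_normB _ _) _.
have -> : e = e / 2 + e / 2 by rewrite -mulrDl -mulr2n -[e *+ 2]mulr_natr mulfK.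
by rewrite ltrD // hN.
Qed.

Hypothesis hL : forall j, shift_equiv l (fun n => laurent P n (P n) j)
                                        (fun n => laurent Q n (Q n) j).

(** By induction on d, multiplying by one more ratio at each step. *)
Lemma laurent_shift_equiv d i :
  shift_equiv l (fun m => laurent P m (P (m - d)%N) i)
                (fun m => laurent Q m (Q (m - d)%N) i).
Proof.
elim: d i => [|d IH] i.
  by apply: (shift_equiv_eq (N := 0)) (hL i) => n _; rewrite subn0.
pose u n := \sum_(s < i) laurent P n.-1 (P (n.-1 - d)%N) s *
                laurent P n (P n) (i - s.+1).
pose v n := \sum_(s < i) laurent Q n.-1 (Q (n.-1 - d)%N) s *
                laurent Q n (Q n) (i - s.+1).
have : shift_equiv l u v.
  apply: (@shift_equiv_sum _ _
    (fun s n => laurent P n.-1 (P (n.-1 - d)%N) s * laurent P n (P n) (i - s.+1))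
    (fun s n => laurent Q n.-1 (Q (n.-1 - d)%N) s * laurent Q n (Q n) (i - s.+1))).
  by move=> s _; apply: shift_equivM => //; exact: shift_equiv_pred (IH s).
apply: (shift_equiv_eq (N := 1)) => -[//|n] _; rewrite /u /v /= subSS.
rewrite (laurent_convolution hP) ?(laurent_convolution hQ) //;
  by rewrite ?(ortho_size hP) ?(ortho_size hQ) ltnS leq_subr.
Qed.

(** The triangular system expresses these coefficients polynomially through the
    Laurent coefficients, by the same formula for both measures. *)
Lemma connection_shift_equiv j i : (i <= j)%N ->
  shift_equiv l (fun m => ocoef B1 P ('X^j * P (m - j)%N) (m - i))
                (fun m => ocoef B2 Q ('X^j * Q (m - j)%N) (m - i)).
Proof.
elim/ltn_ind: i => i IH ij.
apply: (shift_equiv_eq (N := j)) (shift_equivB (laurent_shift_equiv j (i + j))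
  (@shift_equiv_sum _ _
    (fun t m => ocoef B1 P ('X^j * P (m - j)%N) (m - t) * laurent P m (P (m - t)%N) i)
    (fun t m => ocoef B2 Q ('X^j * Q (m - j)%N) (m - t) * laurent Q m (Q (m - t)%N) i)
    i _)) => [m jm|t ti].
  rewrite (laurent_connection hB1 hP ij jm) (laurent_connection hB2 hQ ij jm).
  by rewrite /=; split; ring.
apply: shift_equivM; last exact: laurent_shift_equiv.
by apply: IH => //; lia.
Qed.

Lemma moment_shift_null j :
  moment B1 P j n - moment B2 Q j (n - l)%N @[n --> \oo] --> (0 : C^o).
Proof.
have [_ /null_seqP h] := connection_shift_equiv (leqnn j).
apply/null_seqP => e /h [N hN]; exists (N + l)%N => n nN.
have /hN : (N <= n + j)%N by lia.
have -> : (n + j - l)%N = (n - l + j)%N by lia.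
by rewrite !addnK.
Qed.
End RelativeAsymptotics.

(** * The support of a Borel measure on the plane *)

Section BorelPlane.
Local Open Scope complex_scope.
Variable R : realType.
Local Notation C := R[i].

Lemma norm_imag : `|'i%C : C| = 1.
Proof. by rewrite normc_def /= expr0n expr1n add0r sqrtr1. Qed.

Lemma norm_Im (z : C) : `|complex.Im z|%:C <= `|z|.
Proof.
have := normc_ge_Re (z * 'i%C).
by rewrite ReiNIm normrN normrM norm_imag mulr1.
Qed.

Lemma near_norm_lt (z : C^o) (e : R) : 0 < e ->
  \forall w \near z, `|z - w| < e%:C.
Proof.
move=> e0; apply/nbhs_ballP; exists e%:C; first by rewrite /= ltcR.
by move=> w; rewrite -ball_normE.
Qed.

Lemma continuous_Re : continuous (fun z : C^o => complex.Re (z : C) : R).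
Proof.
move=> z; apply/(@cvgrPdist_lt _ _ _ (nbhs (z : C^o)) (nbhs_filter _)) => e e0.
have := near_norm_lt z e0; apply: (@filterS _ (nbhs (z : C^o)) (nbhs_filter _)) => w zw.
rewrite -ltcR; apply: le_lt_trans zw; rewrite -raddfB; exact: normc_ge_Re.
Qed.

Lemma continuous_Im : continuous (fun z : C^o => complex.Im (z : C) : R).
Proof.
move=> z; apply/(@cvgrPdist_lt _ _ _ (nbhs (z : C^o)) (nbhs_filter _)) => e e0.
have := near_norm_lt z e0; apply: (@filterS _ (nbhs (z : C^o)) (nbhs_filter _)) => w zw.
rewrite -ltcR; apply: le_lt_trans zw; rewrite -raddfB; exact: norm_Im.
Qed.

Lemma normcE (z : C) : (Normc.normc z)%:C = `|z|.
Proof. by []. Qed.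

Lemma norm_real (x : R) : `|x%:C| = `|x|%:C.
Proof. by rewrite normc_def /= expr0n addr0 sqrtr_sqr. Qed.

Lemma norm_le_ReIm (z : C) : `|z| <= (`|complex.Re z| + `|complex.Im z|)%:C.
Proof.
rewrite [z in leLHS]complexE rmorphD /= -!norm_real.
apply: le_trans (ler_normD _ _) _.
by rewrite lerD2l normrM norm_imag mul1r.
Qed.

Lemma continuous_normc : continuous (fun z : C^o => Normc.normc (z : C) : R).
Proof.
move=> z; apply/(@cvgrPdist_lt _ _ _ (nbhs (z : C^o)) (nbhs_filter _)) => e e0.
have := near_norm_lt z e0; apply: (@filterS _ (nbhs (z : C^o)) (nbhs_filter _)) => w zw.
rewrite -ltcR; apply: le_lt_trans zw.
have -> : `|Normc.normc (z : C) - Normc.normc (w : C)|%:C = `| `|z : C| - `|w : C| |.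
  by rewrite -norm_real rmorphB.
exact: ler_dist_dist.
Qed.

Lemma open_measurableC (U : set C^o) : open U -> measurable (U : set (borelC R)).
Proof. exact: sub_gen_smallest. Qed.

Lemma continuous_measurableC (f : C^o -> R) : continuous f ->
  measurable_fun setT (f : borelC R -> R).
Proof.
move=> /continuousP cf.
apply: (measurability _ (measurable_realfun.RGenOpens.measurableE R)).
move=> _ [_ [a [b ->] <-]]; rewrite setTI; apply: open_measurableC.
exact/cf/interval_open.
Qed.

(** Open rectangles with rational sides, a countable base of the plane. *)
Definition rect (q : rat * rat * (rat * rat)) : set C^o :=
  [set z | (ratr q.1.1 < complex.Re (z : C) < ratr q.1.2)
           && (ratr q.2.1 < complex.Im (z : C) < ratr q.2.2)].

Lemma open_rect q : open (rect q).
Proof.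
have -> : rect q = ((fun z : C^o => complex.Re (z : C) : R) @^-1` `]ratr q.1.1, ratr q.1.2[%classic)
   `&` ((fun z : C^o => complex.Im (z : C) : R) @^-1` `]ratr q.2.1, ratr q.2.2[%classic).
  apply/seteqP; split => z /=; rewrite !in_itv /=.
    by move=> /andP.
  by move=> ?; apply/andP.
apply: openI; apply: open_comp; try exact: interval_open.
  by move=> z _; exact: continuous_Re.
by move=> z _; exact: continuous_Im.
Qed.

Lemma rect_basis (U : set C^o) (z : C^o) : open U -> U z ->
  exists q, rect q z /\ rect q `<=` U.
Proof.
move=> oU Uz.
have /nbhs_ballP[e e0 eU] : nbhs z U by apply: open_nbhs_nbhs.
have [r r0 re] : exists2 r : R, 0 < r & r%:C = e.
  move: e0; rewrite /= ltcE /= => /andP[/eqP ie re]; exists (complex.Re e) => //.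
  by case: (e) ie => a b /= ->.
have r20 : 0 < r / 2 by rewrite divr_gt0.
have near_rat (x : R) : exists a b : rat,
    [/\ x - r / 2 < ratr a, ratr a < x, x < ratr b & ratr b < x + r / 2].
  have [|a] := @rat_in_itvoo _ (x - r / 2) x; first by rewrite ltrBlDr ltrDl.
  have [|b] := @rat_in_itvoo _ x (x + r / 2); first by rewrite ltrDl.
  by rewrite !in_itv /= => /andP[? ?] /andP[? ?]; exists a, b.
have [a [b [ha az zb hb]]] := near_rat (complex.Re (z : C)).
have [c [d [hc cz zd hd]]] := near_rat (complex.Im (z : C)).
exists ((a, b), (c, d)); split; first by rewrite /rect /= az zb cz zd.
move=> w /= /andP[/andP[aw wb] /andP[cw wd]]; apply: eU.
rewrite -ball_normE /= -re; apply: le_lt_trans (norm_le_ReIm _) _.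
rewrite ltcR !raddfB /= [ltRHS](splitr r) ltrD // ltr_norml; apply/andP; split; lra.
Qed.

Variable mu : {measure set (borelC R) -> \bar R}.

Lemma open_setC_msupport : open (~` msupport mu).
Proof.
rewrite openE => z /existsNP[U /not_implyP[oU /not_implyP[Uz U0]]].
apply: (@filterS _ (nbhs (z : C^o)) (nbhs_filter _) U); last exact: open_nbhs_nbhs.
by move=> w Uw wS; apply: U0; exact: wS.
Qed.

Lemma measurable_msupport : measurable (msupport mu : set (borelC R)).
Proof.
by rewrite -(setCK (msupport mu)); apply: measurableC; apply: open_measurableC open_setC_msupport.
Qed.

(** Each point outside the support has a null open neighbourhood, hence lies in a
    null rational rectangle, and there are countably many of these. *)
Lemma measure_setC_msupport : mu (~` msupport mu) = 0%E.
Proof.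
apply: measure_negligible; first exact: open_measurableC open_setC_msupport.
pose F n : set (borelC R) := match unpickle n with
  | Some q => if mu (rect q) == 0%E then rect q else set0 | None => set0 end.
have sub : (~` msupport mu : set (borelC R)) `<=` \bigcup_n F n.
  move=> z /existsNP[U /not_implyP[oU /not_implyP[Uz U0]]].
  have [q [qz qU]] := rect_basis oU Uz.
  have q0 : mu (rect q) = 0%E; last first.
    by exists (pickle q); [exact: I|rewrite /F pickleK q0 eqxx].
  apply/eqP; rewrite -measure_le0; apply: le_trans (_ : mu U <= 0)%E.
    by apply: le_measure => //; rewrite inE; apply: open_measurableC => //; exact: open_rect.
  by rewrite leNgt; apply/negP.
apply: (@negligibleS _ _ _ mu _ _ sub); apply: negligible_bigcup => n; rewrite /F.
case: unpickle => [q|]; last exact: negligible_set0.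
case: eqP => [q0|_]; last exact: negligible_set0.
by exists (rect q); split => //; apply: open_measurableC; exact: open_rect.
Qed.
End BorelPlane.

(** * Integration of functions bounded on the support *)

Section BoundedIntegrands.
Local Open Scope complex_scope.
Variables (R : realType) (mu : {measure set (borelC R) -> \bar R}).
Hypothesis mu_fin : (mu setT < +oo)%E.
Local Notation C := R[i].
Implicit Types f g : borelC R -> C.

(** Polynomials are unbounded on the plane, so the bound is asked on the support
    only. *)
Record tame f : Prop := Tame {
  tame_Re : measurable_fun setT (fun z => complex.Re (f z) : R);
  tame_Im : measurable_fun setT (fun z => complex.Im (f z) : R);
  tame_bound : exists M : R, forall z, msupport mu z -> `|f z| <= M%:C }.

Lemma ReM (x y : C) :
  complex.Re (x * y) = complex.Re x * complex.Re y - complex.Im x * complex.Im y.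
Proof. by case: x; case: y. Qed.

Lemma ImM (x y : C) :
  complex.Im (x * y) = complex.Re x * complex.Im y + complex.Im x * complex.Re y.
Proof. by case: x => a b; case: y. Qed.

Lemma tame_cst c : tame (fun=> c).
Proof.
split; [exact: measurable_cst|exact: measurable_cst|].
by exists (Normc.normc c) => z _; rewrite normcE.
Qed.

Lemma tameD f g : tame f -> tame g -> tame (fun z => f z + g z).
Proof.
move=> [f1 f2 [M hM]] [g1 g2 [N hN]]; split.
- by under eq_fun do rewrite raddfD; exact: measurable_funD.
- by under eq_fun do rewrite raddfD; exact: measurable_funD.
exists (M + N) => z zS; rewrite rmorphD (le_trans (ler_normD _ _)) // lerD //.
  exact: hM.
exact: hN.
Qed.

Lemma tameM f g : tame f -> tame g -> tame (fun z => f z * g z).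
Proof.
move=> [f1 f2 [M hM]] [g1 g2 [N hN]]; split.
- by under eq_fun do rewrite ReM; apply: measurable_funB; exact: measurable_funM.
- by under eq_fun do rewrite ImM; apply: measurable_funD; exact: measurable_funM.
by exists (M * N) => z zS; rewrite rmorphM normrM ler_pM // ?hM ?hN.
Qed.

Lemma tameB f g : tame f -> tame g -> tame (fun z => f z - g z).
Proof.
move=> tf tg; have := tameD tf (tameM (tame_cst (-1)) tg).
by under eq_fun do rewrite mulN1r.
Qed.

Lemma tame_conj f : tame f -> tame (fun z => Num.conj (f z)).
Proof.
move=> [f1 f2 [M hM]]; split.
- by move: f1; congr (measurable_fun _ _); apply/funext => z; case: (f z).
- have -> : (fun z => complex.Im (Num.conj (f z))) = (fun z => - complex.Im (f z)).
    by apply/funext => z; case: (f z).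
  exact: measurable_funN.
by exists M => z zS; rewrite norm_conjC hM.
Qed.

Lemma bounded_integrable (h : borelC R -> R) (M : R) :
  measurable_fun setT h -> (forall z, msupport mu z -> `|h z| <= M) ->
  mu.-integrable setT (EFin \o h).
Proof.
move=> mh hM; apply/(@negligible_integrable _ _ _ mu setT (~` msupport mu)) => //.
- exact: (open_measurableC (@open_setC_msupport _ mu)).
- exact/measurable_EFinP.
- exact: measure_setC_msupport.
rewrite setTD setCK; apply: measurable_bounded_integrable.
- exact: measurable_msupport.
- by apply: le_lt_trans mu_fin; apply: le_measure => //; rewrite inE //; exact: measurable_msupport.
- exact: measurable_funS mh.
exists M; split; first exact: num_real.
by move=> x Mx z zS; apply: le_trans (hM z zS) (ltW Mx).
Qed.

Lemma tame_integrable_Re f : tame f ->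
  mu.-integrable setT (EFin \o (fun z => complex.Re (f z))).
Proof.
move=> [f1 _ [M hM]]; apply: (bounded_integrable (M := M)) => // z zS.
by rewrite -lecR (le_trans (normc_ge_Re _)) ?hM.
Qed.

Lemma tame_integrable_Im f : tame f ->
  mu.-integrable setT (EFin \o (fun z => complex.Im (f z))).
Proof.
move=> [_ f2 [M hM]]; apply: (bounded_integrable (M := M)) => // z zS.
by rewrite -lecR (le_trans (norm_Im _)) ?hM.
Qed.

Lemma CintegralD f g : tame f -> tame g ->
  Cintegral mu (fun z => f z + g z) = Cintegral mu f + Cintegral mu g.
Proof.
move=> tf tg; rewrite /Cintegral; congr (_ +i* _).
- under eq_Rintegral do rewrite raddfD.
  by rewrite RintegralD //; exact: tame_integrable_Re.
- under eq_Rintegral do rewrite raddfD.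
  by rewrite RintegralD //; exact: tame_integrable_Im.
Qed.

Lemma CintegralZ c f : tame f ->
  Cintegral mu (fun z => c * f z) = c * Cintegral mu f.
Proof.
move=> tf; have iR := tame_integrable_Re tf; have iI := tame_integrable_Im tf.
have iZ (r : R) h : mu.-integrable setT (EFin \o h) ->
    mu.-integrable setT (EFin \o (fun z => r * h z)).
  by move=> ih; exact: (integrableZl measurableT r ih).
apply/eqP; rewrite eq_complex ReM ImM /=; apply/andP; split; apply/eqP.
- under eq_Rintegral do rewrite ReM.
  rewrite RintegralB //; try exact: iZ.
  by rewrite !RintegralZl.
- under eq_Rintegral do rewrite ImM.
  rewrite RintegralD //; try exact: iZ.
  by rewrite !RintegralZl.
Qed.

Lemma Cintegral_conj f : tame f ->
  Cintegral mu (fun z => Num.conj (f z)) = Num.conj (Cintegral mu f).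
Proof.
move=> tf; have iI := tame_integrable_Im tf.
apply/eqP; rewrite eq_complex /=; apply/andP; split; apply/eqP.
  by apply: eq_Rintegral => z _; case: (f z).
rewrite -mulN1r -RintegralZl //.
by apply: eq_Rintegral => z _; case: (f z) => a b /=; rewrite mulN1r.
Qed.

Lemma Rintegral_msupport h : mu.-integrable setT (EFin \o h) ->
  \int[mu]_z h z = \int[mu]_(z in msupport mu) h z.
Proof.
move=> ih; rewrite /Rintegral (@negligible_integral _ _ _ mu _ (~` msupport mu)) //.
- by rewrite setTD setCK.
- exact: (open_measurableC (@open_setC_msupport _ mu)).
- exact: measure_setC_msupport.
Qed.

Lemma Cintegral_ge0 f : tame f -> (forall z, msupport mu z -> 0 <= f z) ->
  0 <= Cintegral mu f.
Proof.
move=> tf f0; rewrite lecE /= !Rintegral_msupport ?tame_integrable_Re ?tame_integrable_Im //.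
apply/andP; split.
  rewrite (@eq_Rintegral _ _ _ mu _ (fun=> 0)) => [|z].
    by rewrite Rintegral_cst ?mul0r //; exact: measurable_msupport.
  by rewrite inE => /f0; rewrite lecE => /andP[/eqP].
by apply: Rintegral_ge0 => z /f0; rewrite lecE => /andP[].
Qed.

Lemma CintegralB f g : tame f -> tame g ->
  Cintegral mu (fun z => f z - g z) = Cintegral mu f - Cintegral mu g.
Proof.
move=> tf tg; rewrite -mulN1r -CintegralZ // -CintegralD //.
  by congr (Cintegral mu); apply/funext => z; rewrite mulN1r.
exact: tameM (tame_cst _) tg.
Qed.

Hypothesis mu_compact : compact (msupport mu).

Lemma msupport_norm_le : has_ubound [set Normc.normc z | z in msupport mu].
Proof.
have : compact [set Normc.normc z | z in msupport mu].
  apply: (@continuous_compact C^o R) => //; apply: continuous_subspaceT.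
  exact: continuous_normc.
move=> /compact_bounded[M [_ hM]]; exists (M + 1) => x Ax.
by apply: le_trans (ler_norm _) _; apply: hM => //; rewrite ltrDl.
Qed.

Lemma norm_le_msupport_radius (z : C) :
  msupport mu z -> `|z| <= (msupport_radius mu)%:C.
Proof.
move=> zS; rewrite -normcE lecR; apply: ub_le_sup; first exact: msupport_norm_le.
by exists z.
Qed.

Lemma msupport_radius_ge0 : msupport mu !=set0 -> 0 <= msupport_radius mu.
Proof.
move=> [z zS]; rewrite -ler0c; exact: le_trans (normr_ge0 z) (norm_le_msupport_radius zS).
Qed.

Lemma tame_id : tame (fun z => z).
Proof.
split.
- exact: continuous_measurableC (@continuous_Re R).
- exact: continuous_measurableC (@continuous_Im R).
by exists (msupport_radius mu) => z; exact: norm_le_msupport_radius.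
Qed.

Lemma tame_horner (f : {poly C}) : tame (fun z => f.[z]).
Proof.
elim/poly_ind: f => [|f c IH].
  by under eq_fun do rewrite horner0; exact: tame_cst.
under eq_fun do rewrite hornerMXaddC.
by apply: tameD (tame_cst c); apply: tameM IH tame_id.
Qed.

Definition L2form (f g : {poly C}) : C :=
  Cintegral mu (fun z => f.[z] * (g.[z])^*).

Lemma tame_L2form (f g : {poly C}) : tame (fun z => f.[z] * (g.[z])^*).
Proof. apply: tameM; [|apply: tame_conj]; exact: tame_horner. Qed.

(** On the support, |z f|^2 <= rho^2 |f|^2 pointwise. *)
Lemma bounded_L2form :
  msupport mu !=set0 -> bounded_form L2form (msupport_radius mu)%:C.
Proof.
move=> S0; split.
- move=> a f g h; rewrite /L2form -(CintegralZ a (tame_L2form f h)).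
  rewrite -(CintegralD (tameM (tame_cst a) (tame_L2form f h)) (tame_L2form g h)).
  congr (Cintegral mu); apply/funext => z.
  by rewrite hornerD hornerZ mulrDl mulrA.
- move=> f g; rewrite /L2form -(Cintegral_conj (tame_L2form f g)).
  congr (Cintegral mu); apply/funext => z.
  by rewrite rmorphM /= conjCK mulrC.
- move=> f; apply: Cintegral_ge0 => [|z _]; first exact: tame_L2form.
  by rewrite -normCK exprn_ge0.
- by rewrite ler0c msupport_radius_ge0.
move=> f; pose c := (msupport_radius mu)%:C ^+ 2.
have tcf := tameM (tame_cst c) (tame_L2form f f).
have tXf := tame_L2form ('X * f) ('X * f).
rewrite -subr_ge0 /L2form -/c -(CintegralZ c (tame_L2form f f)) -(CintegralB tcf tXf).
apply: Cintegral_ge0 (tameB tcf tXf) _ => z zS.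
rewrite hornerM hornerX -!normCK normrM exprMn -mulrBl mulr_ge0 ?exprn_ge0 //.
rewrite subr_ge0 ler_sqr ?nnegrE ?ler0c ?msupport_radius_ge0 //.
exact: norm_le_msupport_radius.
by case: (z) => a b; exact: sqrtr_ge0.
Qed.

End BoundedIntegrands.

(** * Moments of the zero counting measure *)

Section ZeroCounting.
Local Open Scope complex_scope.
Variable R : realType.
Local Notation C := R[i].

(** The integral is split into positive and negative parts, on which it is
    additive in the measure without integrability conditions. *)
Lemma Rintegral_scaled_dirac_sum (k : {nonneg R}) (s : nat -> borelC R) n
    (h : borelC R -> R) : measurable_fun setT h ->
  \int[mscale k (msum (fun i => \d_(s i)) n)]_z h z = k%:num * \sum_(i < n) h (s i).
Proof.
move=> mh; set nu := mscale _ _.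
have mE : measurable_fun setT (EFin \o h) by exact/measurable_EFinP.
have pos (g : borelC R -> \bar R) : measurable_fun setT g ->
    (forall x, 0 <= g x)%E ->
    (\int[nu]_z g z = k%:num%:E * \sum_(i < n) g (s i))%E.
  move=> mg g0; rewrite ge0_integral_mscale //.
  rewrite ge0_integral_measure_sum //; congr (_ * _)%E.
  by apply: eq_bigr => i _; rewrite integral_dirac // diracT mul1e.
rewrite /Rintegral integralE !pos //; last 2 first.
- exact: measurable_funeneg.
- exact: measurable_funepos.
rewrite funerpos funerneg /= !sumEFin -!EFinM -EFinB /= -mulrBr -sumrB.
congr (_ * _); apply: eq_bigr => i _.
by rewrite -[in RHS](funrposBneg h).
Qed.

Lemma roots_zeros (f : {poly C}) : f \is monic ->
  f = \prod_(i < (size f).-1) ('X - ((zeros f)`_i)%:P) /\ size (zeros f) = (size f).-1.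
Proof.
rewrite /zeros; case: closed_field_poly_normal => r /= + /monicP f1.
rewrite f1 scale1r => fE.
have sr : size r = (size f).-1 by rewrite [in RHS]fE size_prod_XsubC.
by rewrite -sr {1}fE (big_nth 0) big_mkord.
Qed.

Lemma Re_sum n (F : 'I_n -> C) : complex.Re (\sum_i F i) = \sum_i complex.Re (F i).
Proof. exact: (raddf_sum (@complex.Re R : Rcomplex R -> R)). Qed.
Lemma Im_sum n (F : 'I_n -> C) : complex.Im (\sum_i F i) = \sum_i complex.Im (F i).
Proof. exact: (raddf_sum (@complex.Im R : Rcomplex R -> R)). Qed.

Lemma Cintegral_zero_counting (p : nat -> {poly C}) n j :
  size (p n) = n.+1 ->
  Cintegral (zero_counting p n) (fun z => (z : C) ^+ j) =
  n%:R^-1 * \sum_(i < n) (zeros (monic_poly (p n)))`_i ^+ j.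
Proof.
move=> sp; have p0 : p n != 0 by rewrite -size_poly_eq0 sp.
have l0 : lead_coef (p n) != 0 by rewrite lead_coef_eq0.
have mp : monic_poly (p n) \is monic by rewrite monicE lead_coefZ mulVf.
have sz : size (monic_poly (p n)) = n.+1 by rewrite size_scale ?invr_eq0.
have [_ sn] := roots_zeros mp; rewrite sz /= in sn.
have [mR mI] : measurable_fun setT (fun z : borelC R => complex.Re ((z : C) ^+ j) : R)
  /\ measurable_fun setT (fun z : borelC R => complex.Im ((z : C) ^+ j) : R).
  elim: j => [|j [IHR IHI]].
    by split; under eq_fun do rewrite expr0; exact: measurable_cst.
  have mRe := continuous_measurableC (@continuous_Re R).
  have mIm := continuous_measurableC (@continuous_Im R).
  split.
  - under eq_fun do rewrite exprS ReM.
    by apply: measurable_funB; exact: measurable_funM.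
  - under eq_fun do rewrite exprS ImM.
    by apply: measurable_funD; exact: measurable_funM.
rewrite /Cintegral /zero_counting sn.
rewrite (Rintegral_scaled_dirac_sum _ _ _ mR) (Rintegral_scaled_dirac_sum _ _ _ mI) /=.
have -> : n%:R^-1 = (n%:R^-1)%:C :> C by rewrite fmorphV rmorph_nat.
by apply/eqP; rewrite eq_complex ReM ImM /= !mul0r subr0 addr0 Re_sum Im_sum !eqxx.
Qed.
End ZeroCounting.

(** * Orthonormal polynomials of a measure *)

Section OrthonormalPolynomials.
Local Open Scope complex_scope.
Variables (R : realType) (mu : {measure set (borelC R) -> \bar R}).
Hypothesis mu_fin : (mu setT < +oo)%E.
Hypotheses (mu_compact : compact (msupport mu)) (mu_neq0 : msupport mu !=set0).
Variable p : nat -> {poly R[i]}.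
Hypothesis mu_p : orthonormal_polys mu p.
Let hB := bounded_L2form mu_fin mu_compact mu_neq0.
Local Notation P := (fun n => monic_poly (p n)).

Lemma monic_orthogonal_polys : monic_orthogonal (L2form mu) P.
Proof.
have [sp lp op] := mu_p.
have pp n m : L2form mu (p n) (p m) = (n == m)%:R by exact: op.
have PP n m : L2form mu (P n) (P m) =
    (lead_coef (p n))^-1 * (((lead_coef (p m))^-1)^* * (n == m)%:R).
  by rewrite /monic_poly (formZl hB) (formZr hB) pp.
split.
- by move=> n; rewrite monicE lead_coefZ mulVf // gt_eqF.
- by move=> n; rewrite size_scale // invr_eq0 gt_eqF.
- by move=> n m /negPf nm; rewrite PP nm !mulr0.
by move=> n; rewrite PP eqxx mulr1 -normCK exprn_gt0 // normr_gt0 invr_eq0 gt_eqF.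
Qed.

Lemma Cintegral_moment j n :
  Cintegral mu (fun z => (z : R[i]) ^+ j * `|(p n).[z]| ^+ 2)
  = moment (L2form mu) P j n.
Proof.
have [sp lp op] := mu_p.
have l0 : lead_coef (p n) != 0 by rewrite gt_eqF.
have -> : Cintegral mu (fun z => (z : R[i]) ^+ j * `|(p n).[z]| ^+ 2)
    = L2form mu ('X^j * p n) (p n).
  congr (Cintegral mu); apply/funext => z.
  by rewrite hornerM hornerXn normCK mulrA.
have pE : p n = lead_coef (p n) *: P n by rewrite /= scalerA mulfV // scale1r.
have N1 : L2form mu (p n) (p n) = 1 by have := op n n; rewrite eqxx.
rewrite /moment /ocoef -[LHS]divr1 -N1.
move: (lead_coef _) (monic_poly _) l0 pE => a f l0 ->; rewrite -scalerAr.
rewrite !(formZl hB) !(formZr hB).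
by rewrite -!mulf_div !divff ?mul1r // conjC_eq0.
Qed.
End OrthonormalPolynomials.

(** Makes 1/n tend to 0 in the partially ordered field of complex numbers. *)
Lemma complex_archimedean (R : realType) (x : R[i]) :
  0 <= x -> exists n : nat, x <= n%:R.
Proof.
move=> x0; exists (Num.bound (complex.Re x)).
have -> : x = (complex.Re x)%:C%C by rewrite RRe_real // ger0_real.
rewrite -[_%:R](rmorph_nat (real_complex R)) lecR ltW // archi_boundP //.
by move: x0; rewrite lecE => /andP[].
Qed.

Theorem theorem2p2 (R : realType)
  (mu nu : {finite_measure set (borelC R) -> \bar R})
  (mu_compact : compact (msupport mu)) (mu_infinite : infinite_set (msupport mu))
  (nu_compact : compact (msupport nu)) (nu_infinite : infinite_set (msupport nu))
  (p q : nat -> {poly R[i]})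
  (mu_p : orthonormal_polys mu p) (nu_q : orthonormal_polys nu q) :
  (relative_weak_asymptotic_moments mu nu p q ->
     relative_cesaro_weak_asymptotic_moments p q) /\
  (relative_ratio_asymptotics mu nu p q ->
     relative_weak_asymptotic_moments mu nu p q).
Proof.
have mu_fin : (mu setT < +oo)%E by exact: fin_num_fun_lty.
have nu_fin : (nu setT < +oo)%E by exact: fin_num_fun_lty.
have mu_neq0 := infinite_setN0 mu_infinite.
have nu_neq0 := infinite_setN0 nu_infinite.
have hB1 := bounded_L2form mu_fin mu_compact mu_neq0.
have hB2 := bounded_L2form nu_fin nu_compact nu_neq0.
have hP := monic_orthogonal_polys mu_fin mu_compact mu_neq0 mu_p.
have hQ := monic_orthogonal_polys nu_fin nu_compact nu_neq0 nu_q.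
have [sp _ _] := mu_p; have [sq _ _] := nu_q.
have mE j n := Cintegral_moment mu_fin mu_compact mu_neq0 mu_p j n.
have nE j n := Cintegral_moment nu_fin nu_compact nu_neq0 nu_q j n.
split=> [[l hl] j|[l hl]].
  have h : moment (L2form mu) (fun n => monic_poly (p n)) j n
      - moment (L2form nu) (fun n => monic_poly (q n)) j (n - l)%N
      @[n --> \oo] --> (0 : R[i]^o).
    by apply: (null_seq_eq (N := 0)) (hl j) => n _; rewrite mE nE.
  apply: (null_seq_eq (N := 0)) (cesaro_shift_null (@complex_archimedean R)
    (s1 := fun n => \sum_(i < n) (zeros (monic_poly (p n)))`_i ^+ j)
    (s2 := fun n => \sum_(i < n) (zeros (monic_poly (q n)))`_i ^+ j)
    (norm_moment hB2 hQ j) _ _ h) => [n _|n|n].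
  - by rewrite (Cintegral_zero_counting _ (sp n)) (Cintegral_zero_counting _ (sq n)).
  - apply: (sum_roots_moments hB1 hP).
    by have [+ _] := roots_zeros (ortho_monic hP n); rewrite (ortho_size hP).
  - apply: (sum_roots_moments hB2 hQ).
    by have [+ _] := roots_zeros (ortho_monic hQ n); rewrite (ortho_size hQ).
exists l => j.
suff h : moment (L2form mu) (fun n => monic_poly (p n)) j n
    - moment (L2form nu) (fun n => monic_poly (q n)) j (n - l)%N
    @[n --> \oo] --> (0 : R[i]^o).
  by apply: (null_seq_eq (N := 0)) h => n _; rewrite mE nE.
apply: (moment_shift_null hB1 hB2 hP hQ).
apply: (laurent_ortho_shift_equiv hB1 hB2 hP hQ (M :=
  (Num.max (msupport_radius mu) (msupport_radius nu))%:C%C)) => [|z].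
  by rewrite ler0c le_max msupport_radius_ge0.
rewrite -normcE ltcR => /hl /null_seqP h; apply/null_seqP => e /h [N hN].
exists (N + l)%N => n nN; have /hN : (N <= n.+1)%N by lia.
have -> : (n.+1 - 1 = n)%N by lia.
have -> : (n.+1 - l - 1 = n - l)%N by lia.
by have -> : (n.+1 - l = (n - l).+1)%N by lia.
Qed.
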